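(* The class $\mathcal{ES}$ of all $E$-solid semigroups is an $\{\mathsf{E},\mathsf{H},\mathsf{P}\}$-class of semigroups, defined by the following equation system: a semigroup $S$ is $E$-solid if and only if for all $a,b\in S$ there exist $x,y\in S$ such that $x\in V(a)$, $y\in V(b)$, and for every choice of (not necessarily distinct) $g_1,g_2,g_3\in F=\{ax,xa,by,yb\}$ the product $p=g_1g_2g_3$ belongs to a subgroup of $S$.
   Context: For a semigroup $S$ and $a\in S$, $V(a)=\{x\in S: axa=a,\ xax=x\}$ is the set of inverses of $a$; $E(S)$ is the set of idempotents of $S$. $S$ is regular if for every $a\in S$ there is $x\in S$ with $axa=a$. $\mathscr{L},\mathscr{R}$ denote Green's relations. A semigroup $S$ is $E$-solid if it is regular and for all $e,f,g\in E(S)$ with $e\mathrel{\mathscr{L}}f\mathrel{\mathscr{R}}g$ there exists $h\in E(S)$ with $e\mathrel{\mathscr{R}}h\mathrel{\mathscr{L}}g$. The condition that $w$ belongs to a subgroup of $S$ (written $w\in G$ in the paper) is expressed by equations as: there exists $z\in V(w)$ with $wz=zw$. Thus the condition in the theorem is an equation system, i.e. a prenex first-order sentence in the language of one binary operation whose matrix is a finite conjunction of equalities of words (here of the form $\forall a,b\ \exists x,y,z_1,\dots,z_{64}$, with one variable $z_i$ for each product $g_1g_2g_3$). An $\{\mathsf{E},\mathsf{H},\mathsf{P}\}$-class is a class closed under $\mathsf{E}$ (if $A$ embeds elementarily in a member $B$ of the class, then $A$ is in the class), $\mathsf{H}$ (homomorphic images) and $\mathsf{P}$ (direct products). *)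

(* Defs.v *)
From HB Require Import structures.
From mathcomp Require Import all_boot.
From mathcomp Require Import boolp classical_sets functions.

Set Implicit Arguments.
Unset Strict Implicit.
Unset Printing Implicit Defensive.

Local Open Scope classical_set_scope.
Local Open Scope group_scope.

(* [semigroupType] allows an empty carrier; as usual in semigroup theory and in
   first-order logic, semigroups are taken to be nonempty. *)
Record semigroup := Semigroup {
  semigroup_sort :> semigroupType;
  semigroup_inhabited : inhabited semigroup_sort
}.

Section Semigroups.
Variable S : semigroupType.
Implicit Types (a b e f g h w x y : S) (G : set S).

Definition inverses a : set S := [set x | a * x * a = a /\ x * a * x = x].

Definition idempotents : set S := [set e | e * e = e].

Definition regular := forall a, exists x, a * x * a = a.

(* The principal one-sided ideals S^1 a and a S^1. *)
Definition left_ideal a : set S := [set x | x = a \/ exists s, x = s * a].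
Definition right_ideal a : set S := [set x | x = a \/ exists s, x = a * s].

Definition greenL a b := left_ideal a = left_ideal b.
Definition greenR a b := right_ideal a = right_ideal b.

Definition is_subgroup G :=
  (forall g h, G g -> G h -> G (g * h)) /\
  exists e, [/\ G e,
    (forall g, G g -> e * g = g /\ g * e = g) &
    (forall g, G g -> exists h, [/\ G h, g * h = e & h * g = e])].

Definition in_subgroup w := exists G, is_subgroup G /\ G w.

End Semigroups.

Arguments idempotents : clear implicits.
Arguments regular : clear implicits.

Definition E_solid (S : semigroup) :=
  regular S /\
  forall e f g : S, idempotents S e -> idempotents S f -> idempotents S g ->
    greenL e f -> greenR f g ->
    exists h : S, [/\ idempotents S h, greenR e h & greenL h g].

Section DirectProduct.
Variables (I : Type) (S : I -> semigroup).

Definition dprod_sort : Type := forall i, S i.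

Definition dprod_mul (x y : dprod_sort) : dprod_sort := fun i => x i * y i.

Lemma dprod_mulA : associative dprod_mul.
Proof.
by move=> x y z; apply: functional_extensionality_dep => i; exact: mulgA.
Qed.

HB.instance Definition _ := Choice.copy dprod_sort (forall i, S i).
HB.instance Definition _ := isSemigroup.Build dprod_sort dprod_mulA.

Lemma dprod_inhabited : inhabited dprod_sort.
Proof.
have inhS i : exists x : S i, True by case: (semigroup_inhabited (S i)); exists.
by split=> i; case: (cid (inhS i)).
Qed.

Definition dprod : semigroup := Semigroup dprod_inhabited.

End DirectProduct.

(* First-order logic with equality over one binary operation. Variables are
   named by natural numbers; products in terms carry a bracketing, which is
   immaterial in a semigroup. *)
Inductive term :=
  | Var of nat
  | Mul of term & term.

Inductive formula :=
  | Top
  | Eq of term & term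
  | Not of formula
  | And of formula & formula
  | Or of formula & formula
  | Implies of formula & formula
  | All of nat & formula
  | Ex of nat & formula.

Fixpoint term_vars (t : term) : seq nat :=
  match t with
  | Var n => [:: n]
  | Mul s t => term_vars s ++ term_vars t
  end.

Fixpoint eval (S : semigroup) (v : nat -> S) (t : term) : S :=
  match t with
  | Var n => v n
  | Mul s t => eval v s * eval v t
  end.

Fixpoint sat (S : semigroup) (v : nat -> S) (phi : formula) : Prop :=
  match phi with
  | Top => True
  | Eq s t => eval v s = eval v t
  | Not phi => ~ sat v phi
  | And phi psi => sat v phi /\ sat v psi
  | Or phi psi => sat v phi \/ sat v psi
  | Implies phi psi => sat v phi -> sat v psi
  | All n phi => forall a, sat [eta v with n |-> a] phi
  | Ex n phi => exists a, sat [eta v with n |-> a] phi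
  end.

Definition models (S : semigroup) (phi : formula) :=
  forall v : nat -> S, sat v phi.

(* Preservation of all formulas makes f an injective homomorphism. *)
Definition elementary_embedding (A B : semigroup) (f : A -> B) :=
  forall (phi : formula) (v : nat -> A), sat v phi <-> sat (f \o v) phi.

Definition closedE (K : semigroup -> Prop) :=
  forall (A B : semigroup) (f : A -> B),
    elementary_embedding f -> K B -> K A.

Definition closedH (K : semigroup -> Prop) :=
  forall (A B : semigroup) (f : {multiplicative A -> B}),
    range f = setT -> K A -> K B.

Definition closedP (K : semigroup -> Prop) :=
  forall (I : Type) (S : I -> semigroup), (forall i, K (S i)) -> K (dprod S).

Definition EHP_class (K : semigroup -> Prop) :=
  [/\ closedE K, closedH K & closedP K].

Inductive quantifier := Forall | Exists.

(* A prenex sentence whose matrix is a finite conjunction of equalities: the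
   quantifier in position i of the prefix binds the variable i, and every
   variable of the matrix is bound. *)
Record equation_system := EquationSystem {
  eqs_prefix : seq quantifier;
  eqs_matrix : seq (term * term);
  eqs_closed : all (fun st => all (fun n => n < size eqs_prefix)%N
                                  (term_vars st.1 ++ term_vars st.2)) eqs_matrix
}.

Definition eqs_formula (Sigma : equation_system) : formula :=
  foldr (fun qn phi => match qn.1 with
                       | Forall => All qn.2 phi
                       | Exists => Ex qn.2 phi
                       end)
        (foldr (fun st phi => And (Eq st.1 st.2) phi) Top (eqs_matrix Sigma))
        (zip (eqs_prefix Sigma) (iota 0 (size (eqs_prefix Sigma)))).

Definition defined_by (K : semigroup -> Prop) (Sigma : equation_system) :=
  forall S : semigroup, K S <-> models S (eqs_formula Sigma).

(* The variables 0, 1, 2, 3 stand for a, b, x, y, and the variable 4 + i for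
   the witness z attached to the i-th of the 64 products g1 g2 g3. *)
Definition inverse_eqs (s t : term) : seq (term * term) :=
  [:: (Mul (Mul s t) s, s); (Mul (Mul t s) t, t)].

Definition ES_F : seq term :=
  [:: Mul (Var 0) (Var 2); Mul (Var 2) (Var 0);
      Mul (Var 1) (Var 3); Mul (Var 3) (Var 1)].

Definition ES_products : seq term :=
  [seq Mul p g | p <- [seq Mul g1 g2 | g1 <- ES_F, g2 <- ES_F], g <- ES_F].

Definition ES_prefix : seq quantifier := nseq 2 Forall ++ nseq 66 Exists.

Definition ES_matrix : seq (term * term) :=
  inverse_eqs (Var 0) (Var 2) ++ inverse_eqs (Var 1) (Var 3) ++
  flatten [seq inverse_eqs pi.1 (Var pi.2) ++
               [:: (Mul pi.1 (Var pi.2), Mul (Var pi.2) pi.1)]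
          | pi <- zip ES_products (iota 4 64)].

Lemma ES_closed :
  all (fun st => all (fun n => n < size ES_prefix)%N
                     (term_vars st.1 ++ term_vars st.2)) ES_matrix.
Proof. by vm_compute. Qed.

Definition ES_system : equation_system := EquationSystem ES_closed.

(* Main.v *)
Require Import Defs.
From HB Require Import structures.
From mathcomp Require Import all_boot.
From mathcomp Require Import boolp classical_sets functions.

(** A semigroup is handled through its egg-box picture: the R-class of [a] and
    the L-class of [b] cut out a cell, and the cell contains an idempotent
    exactly when it is a subgroup. By the Clifford-Miller theorem, [a * b] lies
    in the cell (R_a, L_b) as soon as the cell (R_b, L_a) is a group.
    E-solidity says that, for idempotents [e] and [g], the cell (R_g, L_e) is a
    group only if the cell (R_e, L_g) is one ([E_solid_sym]).

    If [S] is E-solid, then every product [w] of idempotents lies in a subgroup,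
    so that arbitrary inverses [x] and [y] will do. Indeed the relation saying
    that (R_e, L_g) is a group is then transitive on idempotents [e], [g],
    because R and L commute on idempotents. Given an inverse [t] of
    [w = e1 * ... * en], move the factors of [w] one at a time around the
    product [w * t], from its front to its back. Each of the cyclic shifts met on
    the way is idempotent, consecutive shifts are related
    ([idempotent_rotatable]), and the last one is [t * w]. By transitivity the
    cell (R_(w t), L_(t w)), which is the cell of [w], is a group. The property
    [rotatable] makes this an argument about two factors at a time.

    Conversely let (R_g, L_e) be a group, and take the inverses [x] of [e] and
    [y] of [g] that the condition provides. The Clifford-Miller theorem locates
    (xe)(gy)(yg) in (R_x, L_g), then (yg)(xe)(ex) in (R_y, L_x), and then
    (ex)(yg)(yg) in (R_e, L_g). The first step uses that (R_g, L_e) and the cell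
    of [y] = (yg)(gy)(gy) are groups, each later one that the cell found just
    before is a group, and the last one gives E-solidity.

    The condition is a sentence without negation or implication once membership
    in a subgroup is spelled out as the existence of a commuting inverse
    ([in_subgroupP]). Closure under homomorphic images and direct products
    follows by transporting witnesses, and closure under elementary embeddings
    because the class is defined by a sentence. The equation system is this
    sentence in prenex form: the existential quantifiers over commuting inverses
    can be pulled out because each product has a variable of its own
    ([in_subgroup_tagged]). *)

Set Implicit Arguments.
Unset Strict Implicit.
Unset Printing Implicit Defensive.

Local Open Scope classical_set_scope.
Local Open Scope group_scope.

(** * Green's relations and group cells *)

Section GreenRelations.
Variable S : semigroupType.
Implicit Types (a b c d e f g h t w x y z : S).

Lemma greenR_intro a b s t : a = b * s -> b = a * t -> greenR a b.
Proof.
move=> ab ba; apply/seteqP; split=> u /= [->|[r ->]]; right.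
- by exists s.
- by exists (s * r); rewrite ab mulgA.
- by exists t.
- by exists (t * r); rewrite ba mulgA.
Qed.

Lemma greenL_intro a b s t : a = s * b -> b = t * a -> greenL a b.
Proof.
move=> ab ba; apply/seteqP; split=> u /= [->|[r ->]]; right.
- by exists s.
- by exists (r * s); rewrite ab mulgA.
- by exists t.
- by exists (r * t); rewrite ba mulgA.
Qed.

Lemma greenR_mull c a b : greenR a b -> greenR (c * a) (c * b).
Proof.
move=> ab.
have : right_ideal b a by rewrite -ab; left.
have : right_ideal a b by rewrite ab; left.
case=> [->//|[t bE]] [->//|[s aE]].
by apply: (@greenR_intro _ _ s t); rewrite -mulgA -?aE -?bE.
Qed.

Lemma greenL_mulr c a b : greenL a b -> greenL (a * c) (b * c).
Proof.
move=> ab.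
have : left_ideal b a by rewrite -ab; left.
have : left_ideal a b by rewrite ab; left.
case=> [->//|[t bE]] [->//|[s aE]].
by apply: (@greenL_intro _ _ s t); rewrite mulgA -?aE -?bE.
Qed.

Lemma idempotent_greenR h w : idempotents S h ->
  greenR w h -> h * w = w /\ exists u, w * u = h.
Proof.
rewrite /idempotents /= => hh wh.
have : right_ideal h w by rewrite -wh; left.
have : right_ideal w h by rewrite wh; left.
move=> hw wE; split.
- by case: wE => [->//|[s ->]]; rewrite mulgA hh.
- by case: hw => [<-|[u ->]]; [exists h | exists u].
Qed.

Lemma idempotent_greenL h w : idempotents S h ->
  greenL w h -> w * h = w /\ exists u, u * w = h.
Proof.
rewrite /idempotents /= => hh wh.
have : left_ideal h w by rewrite -wh; left.
have : left_ideal w h by rewrite wh; left.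
move=> hw wE; split.
- by case: wE => [->//|[s ->]]; rewrite -mulgA hh.
- by case: hw => [<-|[u ->]]; [exists h | exists u].
Qed.

Lemma regular_inverse a : regular S -> exists x, inverses a x.
Proof.
move=> /(_ a)[x axa]; exists (x * a * x); split.
- by rewrite !mulgA axa axa.
- have axaM c : a * (x * (a * c)) = a * c by rewrite !mulgA axa.
  by rewrite -!mulgA !axaM.
Qed.

(** Inverses are the elements of the opposite corners of a 2 x 2 block of cells
    whose two other corners contain idempotents. *)
Lemma inverse_idempotents a x : inverses a x ->
  [/\ idempotents S (a * x), greenR (a * x) a & greenL (a * x) x] /\
  [/\ idempotents S (x * a), greenR (x * a) x & greenL (x * a) a].
Proof.
rewrite /idempotents /= => -[axa xax]; split; split.
- by rewrite mulgA axa.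
- by apply: (@greenR_intro _ _ x a).
- by apply: (@greenL_intro _ _ a x); rewrite ?mulgA.
- by rewrite mulgA xax.
- by apply: (@greenR_intro _ _ a x).
- by apply: (@greenL_intro _ _ x a); rewrite ?mulgA.
Qed.

(** A cell of the egg-box that contains an idempotent is a maximal subgroup; for
    the cell of a single element this is [in_subgroup_cell]. *)
Definition group_cell a b :=
  exists h, [/\ idempotents S h, greenR a h & greenL h b].

Lemma group_cell_green a b c d :
  greenR c a -> greenL d b -> group_cell a b -> group_cell c d.
Proof.
move=> ca db [h [hh ah hb]]; exists h; split=> //; first exact: etrans ca ah.
exact/(etrans hb)/esym.
Qed.

(** The Clifford-Miller theorem: right translation by [b] carries the
    idempotent of (R_b, L_a) to [b], hence, acting on the L-class of [a]
    along R-classes, carries [a] into the L-class of [b]. *)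
Lemma group_cell_mul a b : group_cell b a ->
  greenR (a * b) a /\ greenL (a * b) b.
Proof.
move=> [f [ff bf fa]]; have [fb _] := idempotent_greenR ff bf.
have [af _] := idempotent_greenL ff (esym fa).
split; first by rewrite -{2}af; exact: greenR_mull.
by rewrite -{2}fb; apply/greenL_mulr/esym.
Qed.

(** The group is the group of units of the local monoid [e S e] at
    [e = w * z]. *)
Lemma in_subgroupP w :
  in_subgroup w <-> exists z, inverses w z /\ w * z = z * w.
Proof.
split=> [[G [[_ [e [_ eG GV]]] Gw]]|[z [[wzw zwz] wz]]].
  have [z [Gz wz zw]] := GV w Gw; exists z.
  by rewrite /inverses /= wz zw (eG w Gw).1 (eG z Gz).1.
have [e eE] : exists e, w * z = e by exists (w * z).
have [ew we] : e * w = w /\ w * e = w by rewrite -eE wzw wz mulgA wzw.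
have [ez ze] : e * z = z /\ z * e = z by rewrite -eE {1}wz mulgA zwz.
have ee : e * e = e by rewrite -{2}eE mulgA ew.
pose local g := e * g = g /\ g * e = g.
exists [set g | local g /\ exists h, [/\ local h, g * h = e & h * g = e]].
split; last first.
  by split; [split | exists z; split; [split | | rewrite -wz]].
split=> [g g'|] /=.
- case=> -[eg ge] [h [[eh he] gh hg]] [[eg' ge'] [h' [[eh' he'] gh' hg']]].
  split; first by split; rewrite ?mulgA ?eg // -mulgA ge'.
  exists (h' * h); split.
  + by split; rewrite ?mulgA ?eh' // -mulgA he.
  + by rewrite -mulgA (mulgA g') gh' eh gh.
  + by rewrite -mulgA (mulgA h) hg eg' hg'.
- exists e; split; first by split; [split | exists e].
  + by move=> g [[]].
  + by move=> g [lg [h [lh gh hg]]]; exists h; split=> //; split=> //; exists g.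
Qed.

Lemma in_subgroup_cell w : in_subgroup w <-> group_cell w w.
Proof.
split=> [/in_subgroupP[z [wz cwz]]|[h [hh wh hw]]].
  have [[ei eR _] [_ _ eL]] := inverse_idempotents wz.
  by exists (w * z); split=> //; rewrite cwz.
apply/in_subgroupP.
have [hw1 [u wu]] := idempotent_greenR hh wh.
have [wh1 [v vw]] := idempotent_greenL hh (esym hw).
(* A left and a right inverse of w in the local monoid h S h coincide. *)
have vu : h * u = v * h by rewrite -{1}vw -wu mulgA.
have zw : h * u * h * w = h by rewrite vu -(mulgA v) hh -mulgA hw1.
have wz : w * (h * u * h) = h by rewrite !mulgA wh1 wu.
exists (h * u * h); split; last by rewrite wz zw.
by split; rewrite ?wz // zw !mulgA hh.
Qed.

End GreenRelations.

(** * Products of idempotents in E-solid semigroups *)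

Section ESolid.
Variable S : semigroup.
Hypothesis solidS : E_solid S.
Implicit Types (e f g t w : S).

Lemma E_solid_sym e g : idempotents S e -> idempotents S g ->
  group_cell g e -> group_cell e g.
Proof.
by move=> ee gg [f [ff gf fe]]; apply: (solidS.2 _ f) => //; apply/esym.
Qed.

(** In e R h L f R k L g the middle part h L f R k is replaced by
    h R m L k. *)
Lemma group_cell_trans e f g : idempotents S f ->
  group_cell e f -> group_cell f g -> group_cell e g.
Proof.
move=> ff [h [hh eh hf]] [k [kk fk kg]].
apply: (group_cell_green eh (esym kg)).
by apply: (solidS.2 _ f).
Qed.

(** The hypothesis makes both [w * t] and [t * w] idempotent. It is weaker than
    [t] being an inverse of [w], and passes to the factors of [w]. *)
Definition rotatable w := forall t, t * w * t = t -> group_cell (w * t) (t * w).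

Lemma idempotent_rotatable e : idempotents S e -> rotatable e.
Proof.
rewrite /idempotents /= => ee t tet; exists (e * t * e).
have ete : e * t * e * t = e * t by rewrite -!mulgA (mulgA t) tet.
split; first by rewrite /idempotents /= !mulgA -(mulgA _ e e) ee ete.
- by apply: (@greenR_intro _ _ _ t e); rewrite ?ete.
- by apply: (@greenL_intro _ _ _ e t); rewrite !mulgA ?tet.
Qed.

(** Rotate [v], then [w]: if [t] is a weak inverse of [v * w], then [w * t] is
    one of [v] and [t * v] is one of [w]. *)
Lemma mul_rotatable v w : rotatable v -> rotatable w -> rotatable (v * w).
Proof.
move=> rotv rotw t tvwt.
have tE : t * (v * (w * t)) = t by rewrite -[RHS]tvwt !mulgA.
have tEM c : t * (v * (w * (t * c))) = t * c by rewrite -{3}tE !mulgA.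
have cell_v : group_cell (v * (w * t)) (w * t * v).
  by apply: rotv; rewrite -!mulgA tE.
have cell_w : group_cell (w * (t * v)) (t * v * w).
  by apply: rotw; rewrite -!mulgA tEM.
rewrite -!mulgA in cell_v cell_w *.
apply: (group_cell_trans _ cell_v cell_w).
by rewrite /idempotents /= -!mulgA tEM.
Qed.

Lemma rotatable_in_subgroup w : rotatable w -> in_subgroup w.
Proof.
move=> rotw; have [t wt] := regular_inverse w solidS.1.
apply/in_subgroup_cell.
have [[_ wtR _] [_ _ twL]] := inverse_idempotents wt.
exact: group_cell_green (esym wtR) (esym twL) (rotw t wt.2).
Qed.

End ESolid.

(** * The characterization by inverses *)

Definition idempotent_pairs (S : semigroupType) (a b x y : S) : set S :=
  [set u | u = a * x \/ u = x * a \/ u = b * y \/ u = y * b].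

Definition good_inverses (S : semigroupType) (a b x y : S) :=
  [/\ inverses a x, inverses b y &
   forall g1 g2 g3, idempotent_pairs a b x y g1 ->
     idempotent_pairs a b x y g2 -> idempotent_pairs a b x y g3 ->
     in_subgroup (g1 * g2 * g3)].

Definition has_good_inverses (S : semigroup) :=
  forall a b : S, exists x y, good_inverses a b x y.

Lemma E_solid_good_inverses (S : semigroup) : E_solid S -> has_good_inverses S.
Proof.
move=> solidS a b.
have [x ax] := regular_inverse a solidS.1.
have [y bY] := regular_inverse b solidS.1.
exists x, y; split=> // g1 g2 g3 F1 F2 F3.
have idemF g : idempotent_pairs a b x y g -> idempotents S g.
  have [[axi _ _] [xai _ _]] := inverse_idempotents ax.
  have [[byi _ _] [ybi _ _]] := inverse_idempotents bY.
  by move=> [|[|[|]]] ->.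
apply: (rotatable_in_subgroup solidS).
by do 2?[apply: mul_rotatable => //]; apply/idempotent_rotatable/idemF.
Qed.

Lemma good_inverses_E_solid (S : semigroup) : has_good_inverses S -> E_solid S.
Proof.
move=> goodS; split=> [a|e f g ee ff gg ef fg].
  by have [x [_ [[axa _] _ _]]] := goodS a a; exists x.
have ge : group_cell g e by exists f; split=> //; apply/esym.
have [x [y [ex gy sub3]]] := goodS e g.
have [[_ exR exL] [_ xeR xeL]] := inverse_idempotents ex.
have [[_ gyR gyL] [_ ygR ygL]] := inverse_idempotents gy.
have Fex : idempotent_pairs e g x y (e * x) by left.
have Fxe : idempotent_pairs e g x y (x * e) by right; left.
have Fgy : idempotent_pairs e g x y (g * y) by do 2!right; left.
have Fyg : idempotent_pairs e g x y (y * g) by do 3!right.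
have cell3 g1 g2 g3 := fun F1 F2 F3 =>
  (in_subgroup_cell _).1 (sub3 g1 g2 g3 F1 F2 F3).
(* y = (yg)(gy)(gy) lies in a subgroup. *)
have yy : group_cell y y.
  have := cell3 _ _ _ Fyg Fgy Fgy; rewrite -(mulgA (y * g)).
  have [[-> _ _] _] := inverse_idempotents gy.
  by rewrite mulgA -(mulgA y) gg gy.2.
have xexE : x * e * (e * x) = x by rewrite mulgA -(mulgA x) ee ex.2.
have xg : group_cell x g.
  have [gygR gygL] : greenR (g * y * (y * g)) (g * y) /\
      greenL (g * y * (y * g)) (y * g).
    by apply: group_cell_mul; apply: group_cell_green yy.
  have [pR pL] : greenR (x * e * (g * y * (y * g))) (x * e) /\
      greenL (x * e * (g * y * (y * g))) (g * y * (y * g)).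
    apply: group_cell_mul; apply: group_cell_green ge => //.
    exact: etrans gygR gyR.
  have := cell3 _ _ _ Fxe Fgy Fyg; rewrite -(mulgA (x * e)).
  apply: group_cell_green; first exact/esym/(etrans pR).
  by apply/esym/(etrans pL)/(etrans gygL).
have yx : group_cell y x.
  have [pR pL] : greenR (y * g * x) (y * g) /\ greenL (y * g * x) x.
    by apply: group_cell_mul; apply: group_cell_green xg.
  have := cell3 _ _ _ Fyg Fxe Fex; rewrite -(mulgA (y * g)) xexE.
  by apply: group_cell_green; apply/esym => //; apply: etrans pR _.
have [pR pL] : greenR (e * x * (y * g)) (e * x) /\
    greenL (e * x * (y * g)) (y * g).
  by apply: group_cell_mul; apply: group_cell_green yx.
have := cell3 _ _ _ Fex Fyg Fyg; rewrite -(mulgA (e * x)).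
have [_ [-> _ _]] := inverse_idempotents gy.
case/(group_cell_green (esym (etrans pR exR)) (esym (etrans pL ygL))) => h.
by exists h.
Qed.

Lemma E_solidP (S : semigroup) : E_solid S <-> has_good_inverses S.
Proof.
by split; [exact: E_solid_good_inverses | exact: good_inverses_E_solid].
Qed.

(** * Closure under homomorphic images and direct products *)

Lemma in_subgroup_morph (A B : semigroup) (f : {multiplicative A -> B}) w :
  in_subgroup w -> in_subgroup (f w).
Proof.
move=> /in_subgroupP[z [[wzw zwz] wz]]; apply/in_subgroupP; exists (f z).
by rewrite /inverses /= -!gmulfM wzw zwz wz.
Qed.

Lemma E_solid_image : closedH E_solid.
Proof.
move=> A B f fsurj /E_solidP goodA; apply/E_solidP => b b'.
have preim c : exists a, f a = c.
  have : range f c by rewrite fsurj.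
  by case=> a _ <-; exists a.
have [a <-] := preim b; have [a' <-] := preim b'.
have [x [y [[axa xax] [bYb yby] sub3]]] := goodA a a'.
exists (f x), (f y).
split; [by split; rewrite -!gmulfM ?axa ?xax | | move=> g1 g2 g3].
  by split; rewrite -!gmulfM ?bYb ?yby.
have lift g : idempotent_pairs (f a) (f a') (f x) (f y) g ->
    exists2 p, idempotent_pairs a a' x y p & f p = g.
  case=> [|[|[|]]] ->; rewrite -gmulfM; eexists => //.
  - by left.
  - by right; left.
  - by do 2!right; left.
  - by do 3!right.
move=> /lift[p1 F1 <-] /lift[p2 F2 <-] /lift[p3 F3 <-].
by rewrite -!gmulfM; apply/in_subgroup_morph/sub3.
Qed.

Lemma in_subgroup_dprod (I : Type) (S : I -> semigroup) (w : dprod S) :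
  (forall i, in_subgroup (w i)) -> in_subgroup w.
Proof.
move=> subw; apply/in_subgroupP.
have zP i := cid ((in_subgroupP (w i)).1 (subw i)).
exists (fun i => sval (zP i)).
by split; [split|]; apply: functional_extensionality_dep => i;
  case: (svalP (zP i)) => -[].
Qed.

Lemma E_solid_dprod : closedP E_solid.
Proof.
move=> I S solidS; apply/E_solidP => a b.
have good i : exists xy : S i * S i, good_inverses (a i) (b i) xy.1 xy.2.
  by have [x [y xyP]] := (E_solidP (S i)).1 (solidS i) (a i) (b i); exists (x, y).
pose xy i := sval (cid (good i)).
have xyP i : good_inverses (a i) (b i) (xy i).1 (xy i).2 := svalP (cid (good i)).
pose x : dprod S := fun i => (xy i).1; pose y : dprod S := fun i => (xy i).2.
exists x, y; split.
- by split; apply: functional_extensionality_dep => i; case: (xyP i) => -[].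
- by split; apply: functional_extensionality_dep => i; case: (xyP i) => _ [].
- have component g i :
      idempotent_pairs a b x y g ->
      idempotent_pairs (a i) (b i) (x i) (y i) (g i).
    by case=> [|[|[|]]] ->; [left|right; left|do 2!right; left|do 3!right].
  move=> g1 g2 g3 F1 F2 F3; apply: in_subgroup_dprod => i.
  by have [_ _] := xyP i; apply; apply: component.
Qed.

(** * The equation system *)

(* The classical equality test gives access to boolean membership in lists of
   equations. *)
HB.instance Definition _ := gen_eqMixin term.

Lemma mem_zip_iota (T : eqType) (x0 : T) (s : seq T) m x k :
  reflect (exists2 i, i < size s & x = nth x0 s i /\ k = m + i)%N
          ((x, k) \in zip s (iota m (size s))).
Proof.
have size_eq : size s = size (iota m (size s)) by rewrite size_iota.
apply: (iffP (nthP (x0, 0))) => [[i]|[i is_s [-> ->]]].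
  rewrite size_zip -size_eq minnn => is_s.
  by rewrite nth_zip // nth_iota // => -[<- <-]; exists i.
exists i; first by rewrite size_zip -size_eq minnn.
by rewrite nth_zip // nth_iota.
Qed.

Section Satisfaction.
Variable S : semigroup.
Implicit Types (v : nat -> S) (t : term) (eqs : seq (term * term)).

Definition exists_block m n phi :=
  foldr (fun qn phi => match qn.1 with
                       | Forall => All qn.2 phi
                       | Exists => Ex qn.2 phi
                       end) phi (zip (nseq n Exists) (iota m n)).

(** Variables on either side of the block may be free in [phi], so [v'] has to
    keep the values of all of them. *)
Lemma sat_exists_block m n phi v :
  sat v (exists_block m n phi) <->
  exists v', (forall i, (i < m) || (m + n <= i) -> v' i = v i)%N /\ sat v' phi.
Proof.
elim: n m v => [|n IHn] m v.
  split=> [sphi|[v' [v'E]]]; first by exists v.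
  suff -> : v' = v by [].
  by apply: funext => i; apply: v'E; rewrite addn0; case: ltnP.
split=> [[c /IHn[v' [v'E sphi]]]|[v' [v'E sphi]]].
  exists v'; split=> // i iout; rewrite v'E /=.
    by case: eqP iout => // ->; rewrite ltnn addnS ltnNge leq_addr.
  move: iout; rewrite addSnnS.
  by case/orP => [/ltnW im|->]; rewrite ?orbT ?ltnS ?im.
exists (v' m); apply/IHn; exists v'; split=> // i iout /=.
case: eqP => [->//|/eqP im]; apply: v'E.
by move: iout; rewrite addSnnS ltnS leq_eqVlt (negPf im).
Qed.

Definition holds v eqs := forall st, st \in eqs -> eval v st.1 = eval v st.2.

Lemma sat_equations v eqs :
  sat v (foldr (fun st phi => And (Eq st.1 st.2) phi) Top eqs) <-> holds v eqs.
Proof.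
elim: eqs => [|st eqs IHeqs] /=; first by split.
rewrite IHeqs; split=> [[st_eq eqsv] u|eqsv].
  by rewrite inE => /predU1P[->|/eqsv].
by split=> [|u ueqs]; apply: eqsv; rewrite inE ?eqxx ?ueqs ?orbT.
Qed.

Lemma holds_cat v eqs eqs' :
  holds v (eqs ++ eqs') <-> holds v eqs /\ holds v eqs'.
Proof.
split=> [eqsv|[eqsv eqsv'] st]; last by rewrite mem_cat => /orP[/eqsv|/eqsv'].
by split=> st st_eqs; apply: eqsv; rewrite mem_cat st_eqs ?orbT.
Qed.

Lemma holds_inverse_eqs v s t :
  holds v (inverse_eqs s t) <-> inverses (eval v s) (eval v t).
Proof.
split=> [eqsv|[sts tst] u]; last by rewrite !inE => /orP[]/eqP->.
split; first by apply: (eqsv (Mul (Mul s t) s, s)); rewrite inE eqxx.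
by apply: (eqsv (Mul (Mul t s) t, t)); rewrite !inE eqxx orbT.
Qed.

Lemma eval_agree v v' t :
  (forall i, i \in term_vars t -> v' i = v i) -> eval v' t = eval v t.
Proof.
elim: t => [i|s IHs t IHt] /= agree; first by apply: agree; rewrite inE.
rewrite IHs => [|i i_s]; last by apply: agree; rewrite mem_cat i_s.
by rewrite IHt // => i i_t; apply: agree; rewrite mem_cat i_t orbT.
Qed.

Definition subgroup_eqs (pi : term * nat) :=
  inverse_eqs pi.1 (Var pi.2) ++ [:: (Mul pi.1 (Var pi.2), Mul (Var pi.2) pi.1)].

Lemma holds_subgroup_eqs v pi :
  holds v (subgroup_eqs pi) <->
  inverses (eval v pi.1) (v pi.2) /\ eval v pi.1 * v pi.2 = v pi.2 * eval v pi.1.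
Proof.
rewrite holds_cat holds_inverse_eqs; split=> -[inv comm]; split=> //.
  by apply: (comm (Mul pi.1 (Var pi.2), Mul (Var pi.2) pi.1)); rewrite inE eqxx.
by move=> u; rewrite inE => /eqP->.
Qed.

Definition tagged_subgroup_eqs m (ps : seq term) :=
  flatten [seq subgroup_eqs pi | pi <- zip ps (iota m (size ps))].

Lemma holds_tagged m ps v :
  holds v (tagged_subgroup_eqs m ps) <->
  forall pi, pi \in zip ps (iota m (size ps)) -> holds v (subgroup_eqs pi).
Proof.
split=> [eqsv pi pi_zip st st_pi|eqsv st /flatten_mapP[pi pi_zip]].
  by apply: eqsv; apply/flatten_mapP; exists pi.
exact: eqsv.
Qed.

Lemma tagged_in_subgroup m ps v p :
  holds v (tagged_subgroup_eqs m ps) -> p \in ps -> in_subgroup (eval v p).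
Proof.
move=> /holds_tagged eqsv p_ps; apply/in_subgroupP; exists (v (m + index p ps)%N).
apply: (holds_subgroup_eqs v (p, _)).1; apply: eqsv.
by apply/(mem_zip_iota p); exists (index p ps); rewrite ?index_mem ?nth_index.
Qed.

(** Each [p] has its own tag, so the witnesses for the various [p] can be chosen
    independently; the tags lie above the variables of every [p], so the choice
    leaves the values of the [p] unchanged. *)
Lemma in_subgroup_tagged m ps v :
  (forall p, p \in ps -> all (fun i => i < m)%N (term_vars p)) ->
  (forall p, p \in ps -> in_subgroup (eval v p)) ->
  exists v', (forall i, (i < m) || (m + size ps <= i) -> v' i = v i)%N /\
             holds v' (tagged_subgroup_eqs m ps).
Proof.
move=> vars_lt subps.
have /choice[z zP] t : exists z, t \in ps ->
    inverses (eval v t) z /\ eval v t * z = z * eval v t.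
  case: (boolP (t \in ps)) => [/subps/in_subgroupP[z zP]|_]; first by exists z.
  by exists (eval v t).
pose v' i := if (m <= i < m + size ps)%N then z (nth (Var 0%N) ps (i - m)) else v i.
have v'E i : ((i < m) || (m + size ps <= i))%N -> v' i = v i.
  by rewrite /v'; case: (leqP m i) => //= _ out; rewrite ltnNge out.
exists v'; split=> //; apply/holds_tagged => -[p k].
case/(mem_zip_iota (Var 0%N)) => i i_ps [pE kE].
have p_ps : p \in ps by rewrite pE mem_nth.
have v'k : v' k = z p by rewrite /v' kE leq_addr ltn_add2l i_ps addKn -pE.
apply/holds_subgroup_eqs; rewrite /= v'k.
rewrite (@eval_agree v v' p) => [|j j_p]; first exact: zP.
by apply: v'E; rewrite (allP (vars_lt _ p_ps) _ j_p).
Qed.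

Lemma idempotent_pairsP v u :
  idempotent_pairs (v 0%N) (v 1%N) (v 2) (v 3) u <->
  exists2 t, t \in ES_F & eval v t = u.
Proof.
split=> [|[t]].
  by case=> [|[|[|]]] ->;
    [exists (Mul (Var 0%N) (Var 2)) | exists (Mul (Var 2) (Var 0%N)) |
     exists (Mul (Var 1%N) (Var 3)) | exists (Mul (Var 3) (Var 1%N))];
    rewrite ?inE ?eqxx ?orbT.
rewrite !inE => /or4P[]/eqP-> <-; first by left.
- by right; left.
- by do 2!right; left.
- by do 3!right.
Qed.

Lemma ES_products_in_subgroup v :
  (forall p, p \in ES_products -> in_subgroup (eval v p)) <->
  forall g1 g2 g3, idempotent_pairs (v 0%N) (v 1%N) (v 2) (v 3) g1 ->
    idempotent_pairs (v 0%N) (v 1%N) (v 2) (v 3) g2 ->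
    idempotent_pairs (v 0%N) (v 1%N) (v 2) (v 3) g3 -> in_subgroup (g1 * g2 * g3).
Proof.
split=> [subp g1 g2 g3|sub3 p].
  move=> /idempotent_pairsP[t1 F1 <-] /idempotent_pairsP[t2 F2 <-].
  move=> /idempotent_pairsP[t3 F3 <-].
  by apply: (subp (Mul (Mul t1 t2) t3)); do 2!apply: allpairs_f => //.
case/allpairsP=> -[q t3] [/allpairsP[[t1 t2] [F1 F2 ->]] F3 ->] /=.
by apply: sub3; apply/idempotent_pairsP; [exists t1|exists t2|exists t3].
Qed.

Lemma holds_ES_matrix v :
  holds v ES_matrix <->
  [/\ inverses (v 0%N) (v 2), inverses (v 1%N) (v 3) &
      holds v (tagged_subgroup_eqs 4 ES_products)].
Proof.
rewrite 2!holds_cat 2!holds_inverse_eqs.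
by split=> [[? []]|[? ? ?]].
Qed.

Lemma models_ES_system :
  models S (eqs_formula ES_system) <-> has_good_inverses S.
Proof.
pose val v (a b x y : S) : nat -> S :=
  [eta [eta [eta [eta v with 0%N |-> a] with 1%N |-> b] with 2 |-> x] with 3 |-> y].
(* The matrix stays abstract in satE, as unfolding sat on the whole sentence
   exposes 64 nested quantifiers. *)
have satE v phi : sat v (All 0%N (All 1%N (Ex 2 (Ex 3 phi)))) <->
    forall a b, exists x y, sat (val v a b x y) phi by [].
have -> : eqs_formula ES_system = All 0 (All 1 (Ex 2 (Ex 3 (exists_block 4 64
    (foldr (fun st phi => And (Eq st.1 st.2) phi) Top ES_matrix))))).
  by vm_compute.
split=> [modelS a b|goodS v].
  have [x [y]] := (satE (fun=> a) _).1 (modelS _) a b.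
  case/sat_exists_block=> v' [v'E /sat_equations/holds_ES_matrix[ax bY tagged]].
  have := (ES_products_in_subgroup v').1 (fun p => tagged_in_subgroup tagged).
  by rewrite !v'E // in ax bY * => sub3; exists x, y.
apply/satE => a b; have [x [y [ax bY sub3]]] := goodS a b; exists x, y.
have vars_lt p : p \in ES_products -> all (fun i => i < 4)%N (term_vars p).
  case/allpairsP=> -[q t3] [/allpairsP[[t1 t2] [F1 F2 ->]] F3 ->] /=.
  have varsF t : t \in ES_F -> all (fun i => i < 4)%N (term_vars t).
    by rewrite !inE => /or4P[]/eqP->.
  by rewrite !all_cat !varsF.
have := (ES_products_in_subgroup (val v a b x y)).2 sub3.
case/(in_subgroup_tagged vars_lt) => v' [v'E tagged].
apply/sat_exists_block; exists v'; split=> //.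
by apply/sat_equations/holds_ES_matrix; rewrite !v'E.
Qed.

End Satisfaction.

Lemma E_solid_defined : defined_by E_solid ES_system.
Proof. by move=> S; rewrite models_ES_system; exact: E_solidP. Qed.

Lemma defined_by_closedE K Sigma : defined_by K Sigma -> closedE K.
Proof.
move=> defK A B f elemf /defK modB; apply/defK => v; exact/elemf.
Qed.

Theorem theorem4p1 :
  EHP_class E_solid /\
  defined_by E_solid ES_system /\
  (forall S : semigroup,
     E_solid S <->
     forall a b : S, exists x y : S,
       [/\ inverses a x, inverses b y &
        let F : set S := [set u | u = a * x \/ u = x * a \/
                                  u = b * y \/ u = y * b] in
        forall g1 g2 g3 : S, F g1 -> F g2 -> F g3 ->
          in_subgroup (g1 * g2 * g3)]).
Proof.
split; first split.
- exact: defined_by_closedE E_solid_defined.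
- exact: E_solid_image.
- exact: E_solid_dprod.
- by split; [exact: E_solid_defined | exact: E_solidP].
Qed.
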